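(* Let $\rho$ be any given distortion functional which takes as argument a joint distribution $P_{\mathrm{x},\mathrm{y}}$ and yields a non-negative real value. Let $(\mathcal{A}_D)$ be the set of all pairs of two-sided processes $(\mathrm{x}_{-\infty}^\infty,\mathrm{y}_{-\infty}^\infty)$, where $\mathrm{x}_{-\infty}^\infty$ is stationary, with pair-wise distributions $\{P_{\mathrm{x}(k),\mathrm{y}(k)}\}_{k\in\mathbb{Z}}$ which satisfy the asymptotic single-letter fidelity criterion $$\lim_{n\to\infty}\frac1n\sum_{k=1}^n\rho(P_{\mathrm{x}(k),\mathrm{y}(k)})\le D.$$ Then there does not exist an infinite collection of distortion-feasible sets $\{\mathcal{W}_D^{k_1,k_2}\}_{k_1\le k_2\in\mathbb{Z}}$ satisfying ( * ) for every $t_1\in\mathbb{Z}$ and $s,t_2\in\mathbb{N}$ with $t_1\le t_2$, the sets $\mathcal{W}_D^{t_1+s,t_2+s}$ and $\mathcal{W}_D^{t_1,t_2}$ are identical, such that the associated set $\mathcal{W}_D$ (see context) satisfies $(\mathcal{W}_D)=(\mathcal{A}_D)$.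
   Context: Notation: $\mathrm{x}_j^k=(\mathrm{x}(j),\ldots,\mathrm{x}(k))$; $\mathbb{N}=\{1,2,\ldots\}$. $P_{\mathrm{a}}$ is the distribution of $\mathrm{a}$. If $\mathcal{S}$ is a set of probability distributions, $(\mathcal{S})$ is the set of random elements whose distribution belongs to $\mathcal{S}$. Source and reconstruction samples take values in alphabets $\mathcal{X}$ and $\mathcal{Y}$, and $D\ge0$ is the admissible distortion level. The two-sided source has a given distribution, and $\mathcal{P}^{k_1,k_2}$ denotes the set of joint distributions on $\mathcal{X}^{k_2-k_1+1}\times\mathcal{Y}^{k_2-k_1+1}$ whose $\mathcal{X}$-marginal is that of the source block from time $k_1$ to $k_2$. A distortion-feasible set $\mathcal{W}_D^{k_1,k_2}$ is a non-empty subset of $\mathcal{P}^{k_1,k_2}$. Definition of $\mathcal{W}_D$: given distortion-feasible sets $\{\mathcal{W}_D^{k_1,k_2}\}_{k_1\le k_2\in\mathbb{Z}}$, the set $(\mathcal{W}_D)$ consists of all two-sided random process pairs $(\mathrm{x}_{-\infty}^\infty,\mathrm{y}_{-\infty}^\infty)$ for which there exist integers $\cdots<k_{-1}<k_0<k_1<\cdots$ with $\lim_{i\to\pm\infty}k_i=\pm\infty$ and $(\mathrm{x}_{k_i}^{k_{i+1}-1},\mathrm{y}_{k_i}^{k_{i+1}-1})\in(\mathcal{W}_D^{k_i,k_{i+1}-1})$ for all $i\in\mathbb{Z}$.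
   Formalization: Adds that Y is standard Borel and excludes the case where the source is stationary and ρ equals one constant c ≤ D on all single-letter joint laws with the source marginal (there the claim is false); x in both sets has the law of the given source. *)

(* Defs.v *)
From HB Require Import structures.
From mathcomp Require Import all_boot all_order all_algebra.
From mathcomp Require Import all_classical all_reals all_analysis.

Set Implicit Arguments.
Unset Strict Implicit.
Unset Printing Implicit Defensive.

Import Order.TTheory GRing.Theory Num.Theory.
Import numFieldNormedType.Exports.

Local Open Scope classical_set_scope.
Local Open Scope ring_scope.

(* The Borel image of an injective Borel map: [T] is measurably isomorphic to
   a Borel subset of the line, which is the usual meaning of "standard Borel"
   up to Kuratowski's theorem. *)
Definition standard_borel (R : realType) (d : measure_display)
    (T : measurableType d) : Prop :=
  exists f : T -> measurableTypeR R,
    [/\ injective f,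
        measurable_fun [set: T] f &
        forall A : set T, measurable A -> measurable (f @` A)].

(* A [probability] carries a value on every set, including the non-measurable
   ones, where the value is arbitrary; so Leibniz equality is finer than equality
   of distributions, which is agreement on measurable sets. *)
Definition same_dist (R : realType) (d : measure_display)
    (T : measurableType d) (mu nu : probability T R) : Prop :=
  forall A : set T, measurable A -> mu A = nu A.

Section Law.
Context (d d' : measure_display) (T : measurableType d) (U : measurableType d')
  (R : realType) (P : probability T R).

Definition law (X : {RV P >-> U}) : probability U R := distribution P X.

End Law.

(* A two-sided process on a probability space is a family
   [int -> {RV P >-> U}]; [block x k n] is the tuple x(k), ..., x(k + n), of
   length n + 1. *)
Section Blocks.
Context (d dX : measure_display) (T : measurableType d) (R : realType)
  (P : probability T R) (X : measurableType dX).

Definition block_fun (x : int -> {RV P >-> X}) (k : int) (n : nat) (w : T) :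
    n.+1.-tuple X := [tuple x (k + i%:Z) w | i < n.+1].

Lemma block_fun_measurable x k n : measurable_fun [set: T] (block_fun x k n).
Proof.
apply/measurable_fun_tnthP => i.
rewrite (_ : _ \o _ = x (k + i%:Z)); first exact: measurable_funPT.
by apply/funext => w; rewrite /= tnth_mktuple.
Qed.

HB.instance Definition _ x k n :=
  isMeasurableFun.Build _ _ _ _ (block_fun x k n) (@block_fun_measurable x k n).

Definition block (x : int -> {RV P >-> X}) (k : int) (n : nat) :
  {RV P >-> n.+1.-tuple X} := block_fun x k n.

End Blocks.

Section Pairs.
Context (d dX dY : measure_display) (T : measurableType d) (R : realType)
  (P : probability T R) (X : measurableType dX) (Y : measurableType dY).

Definition pair_fun (x : {RV P >-> X}) (y : {RV P >-> Y}) (w : T) : X * Y :=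
  (x w, y w).

Lemma pair_fun_measurable x y : measurable_fun [set: T] (pair_fun x y).
Proof. by apply: measurable_fun_pair; exact: measurable_funPT. Qed.

HB.instance Definition _ x y :=
  isMeasurableFun.Build _ _ _ _ (pair_fun x y) (@pair_fun_measurable x y).

Definition rv_pair (x : {RV P >-> X}) (y : {RV P >-> Y}) :
  {RV P >-> (X * Y)%type} := pair_fun x y.

End Pairs.

(* Equality of process laws, through all finite blocks of consecutive times
   (these determine the law on the product sigma-algebra); the two processes
   may live on different probability spaces. *)
Definition same_process_law (R : realType) (d d' dX : measure_display)
    (T : measurableType d) (T' : measurableType d') (X : measurableType dX)
    (P : probability T R) (P' : probability T' R)
    (x : int -> {RV P >-> X}) (x' : int -> {RV P' >-> X}) : Prop :=
  forall (k : int) (n : nat), same_dist (law (block x k n)) (law (block x' k n)).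

Definition stationary (R : realType) (d dX : measure_display)
    (T : measurableType d) (X : measurableType dX) (P : probability T R)
    (x : int -> {RV P >-> X}) : Prop :=
  forall (k s : int) (n : nat),
    same_dist (law (block x (k + s) n)) (law (block x k n)).

Definition has_fst_marginal (R : realType) (dX dY : measure_display)
    (X : measurableType dX) (Y : measurableType dY)
    (Q : probability (X * Y)%type R) (mu : probability X R) : Prop :=
  forall A : set X, measurable A -> pushforward Q fst A = mu A.

Section Distortion.
Context (R : realType) (dX dY dS : measure_display) (X : measurableType dX)
  (Y : measurableType dY) (S : measurableType dS) (PS : probability S R)
  (src : int -> {RV PS >-> X}).

(* [W k n] stands for the set indexed by k1 = k, k2 = k + n; thus n ranging
   over nat is exactly the range k1 <= k2. *)
Definition dist_sets : Type := int -> forall n : nat,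
  set (probability (n.+1.-tuple X * n.+1.-tuple Y)%type R).

Definition source_couplings : dist_sets := fun k n =>
  [set Q | has_fst_marginal Q (law (block src k n))].

(* The third clause says that [W k n] is a set of distributions, in the sense of
   [same_dist]. *)
Definition distortion_feasible (W : dist_sets) : Prop :=
  forall (k : int) (n : nat),
    [/\ W k n !=set0,
        W k n `<=` @source_couplings k n &
        forall Q Q', same_dist Q Q' -> W k n Q -> W k n Q'].

(* Only blocks whose last time t2 = t1 + n is positive are constrained. *)
Definition shift_invariant (W : dist_sets) : Prop :=
  forall (t1 : int) (s n : nat), (1 <= s)%N -> 1 <= t1 + n%:Z ->
    W (t1 + s%:Z) n = W t1 n.

Section Pair_of_processes.
Context (d : measure_display) (T : measurableType d) (P : probability T R)
  (x : int -> {RV P >-> X}) (y : int -> {RV P >-> Y}).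

(* Membership of (x, y) in the set of process pairs generated by [W]; the
   first component is a copy of the given source. *)
Definition in_W (W : dist_sets) : Prop :=
  same_process_law x src /\
  exists k : int -> int,
    [/\ forall i : int, k i < k (i + 1),
        forall M : int, exists N : int, forall i : int, N <= i -> M <= k i,
        forall M : int, exists N : int, forall i : int, i <= N -> k i <= M &
        forall (i : int) (n : nat), k (i + 1) - 1 = k i + n%:Z ->
          W (k i) n (law (rv_pair (block x (k i) n) (block y (k i) n)))].

Definition avg_distortion (rho : probability (X * Y)%type R -> R) (n : nat) : R :=
  n%:R^-1 * \sum_(1 <= k < n.+1) rho (law (rv_pair (x k%:Z) (y k%:Z))).

(* The limit is required to exist. *)
Definition in_A (rho : probability (X * Y)%type R -> R) (D : R) : Prop :=
  [/\ same_process_law x src, stationary x &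
      exists2 l : R, avg_distortion rho @ \oo --> l & l <= D].

End Pair_of_processes.

(* The degenerate situation in which every reconstruction of a stationary
   source meets the fidelity criterion: rho takes a single value, at most D, on
   all the single-letter joint distributions compatible with the source. *)
Definition vacuous_criterion (rho : probability (X * Y)%type R -> R) (D : R) :
    Prop :=
  stationary src /\
  exists2 c : R, c <= D &
    forall (k : int) (Q : probability (X * Y)%type R),
      has_fst_marginal Q (law (src k)) -> rho Q = c.

End Distortion.

(* Main.v *)
Require Import Defs.
From HB Require Import structures.
From mathcomp Require Import all_boot all_order all_algebra.
From mathcomp Require Import all_classical all_reals all_analysis.
From mathcomp Require Import measurable_realfun zify ring lra.

Set Implicit Arguments.
Unset Strict Implicit.
Unset Printing Implicit Defensive.

Import Order.TTheory GRing.Theory Num.Theory.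
Import numFieldNormedType.Exports.

Local Open Scope classical_set_scope.
Local Open Scope ring_scope.

(* Write V_n for the common value of the sets W k n with k + n >= 1.  Drive the
   reconstruction by one uniform variable u independent of the source,
   y(k) = g_k(x(k), u): any single-letter joint law with the right marginal is
   reached by a suitable g_k, and the law of a block depends only on the functions
   g_k used in it.

   If the two sets of process pairs coincide, repeating a single letter of V_0
   shows that the source is stationary and that this letter has distortion c <= D.
   Some letter law has a distortion b <> c, since otherwise the criterion is
   vacuous.  Placing one letter of distortion b at time 1 in a process repeating the
   first letter does not change the limiting average, so the block that covers
   time 1 belongs to some V_n, although its average is not c.  Concatenating copies
   of this block and of the letter in V_0 with oscillating frequencies stays in the
   set generated by W, but the average distortion then has
   no limit. *)

(** * Sampling a joint distribution from its first marginal and a uniform noise *)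

Section noise.
Context (R : realType).

Definition noise : probability (measurableTypeR R) R := uniform_prob (@ltr01 R).

Lemma noise_lt (r : R) : 0 <= r ->
  noise [set u | u < r] = (Num.min r 1)%:E.
Proof.
move=> r0; rewrite /noise /= /uniform_prob integral_uniform_pdf.
rewrite (eq_integral (fun=> 1%E)); last first.
  by move=> u; rewrite inE /= in_itv /= /uniform_pdf => -[_ ->]; rewrite subr0 invr1.
have mI : measurable (`]-oo, r[ `&` `[0, 1] : set (measurableTypeR R)).
  by apply: measurableI; exact: measurable_itv.
rewrite -set_itvNyo integral_cst//= mul1e.
apply/eqP; rewrite eq_le; apply/andP; split.
- rewrite EFin_min le_min; apply/andP; split.
    have -> : r%:E = lebesgue_measure (`[0%R, r[%classic : set (measurableTypeR R)).
      rewrite lebesgue_measure_itv/= lte_fin; case: ifPn => [_|]; first by rewrite sube0.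
      by rewrite -leNgt => r_le0; congr EFin; apply/eqP; rewrite eq_le r_le0.
    apply: le_measure; rewrite ?inE//.
    by move=> u /=; rewrite !in_itv/= => -[-> /andP[-> _]].
  have -> : 1%E = lebesgue_measure (`[0%R, 1%R]%classic : set (measurableTypeR R)).
    by rewrite lebesgue_measure_itv/= lte_fin ltr01 sube0.
  apply: le_measure; rewrite ?inE//.
have -> : (Num.min r 1)%:E
    = lebesgue_measure (`[0%R, Num.min r 1[%classic : set (measurableTypeR R)).
  rewrite lebesgue_measure_itv/= lte_fin; case: ifPn => [_|]; first by rewrite sube0.
  rewrite -leNgt => min_le0; congr EFin; apply/eqP.
  by rewrite eq_le min_le0 le_min r0 ler01.
apply: le_measure; rewrite ?inE//.
move=> u /=; rewrite !in_itv/= => /andP[-> ]; rewrite lt_min => /andP[-> /ltW ->].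
by [].
Qed.

End noise.
Arguments noise R : clear implicits.

(** * Conditional probabilities as regions under a graph *)

Section slab.
Context (d d' : measure_display) (X : measurableType d) (Z : measurableType d')
  (R : realType) (Q : probability Z R) (p : {mfun Z >-> X}) (B : set Z).
Hypothesis mB : measurable B.

Local Open Scope ereal_scope.

Let nu (A : set X) : \bar R := Q (p @^-1` A `&` B).

Let mpre (A : set X) : measurable A -> measurable (p @^-1` A).
Proof. by move=> mA; rewrite -[_ @^-1` _]setTI; exact: measurable_funPT. Qed.

Let nu0 : nu set0 = 0.
Proof. by rewrite /nu preimage_set0 set0I measure0. Qed.

Let nu_ge0 A : 0 <= nu A. Proof. exact: measure_ge0. Qed.

Let nu_sigma_additive : semi_sigma_additive nu.
Proof.
move=> F mF tF mUF; rewrite /nu preimage_bigcup setI_bigcupl.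
apply: measure_semi_sigma_additive.
- by move=> n; apply: measurableI => //; exact: mpre.
- apply/trivIsetP => i j _ _ ij; rewrite setIACA -preimage_setI.
  by move/trivIsetP : tF => /(_ _ _ _ _ ij) ->//; rewrite preimage_set0 set0I.
- rewrite -setI_bigcupl -preimage_bigcup; apply: measurableI => //; exact: mpre.
Qed.

HB.instance Definition _ := isMeasure.Build _ _ _ nu nu0 nu_ge0 nu_sigma_additive.

Let nu_fin : fin_num_fun nu.
Proof.
by move=> A mA; apply: fin_num_measure; apply: measurableI => //; exact: mpre.
Qed.

HB.instance Definition _ := Measure_isFinite.Build _ _ _ nu nu_fin.

Let mu : probability X R := distribution Q p.

Let nu_le A : measurable A -> nu A <= mu A.
Proof.
move=> mA; apply: le_measure; rewrite ?inE; last exact: subIsetl.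
- by apply: measurableI => //; exact: mpre.
- exact: mpre.
Qed.

Let numu : nu `<< mu.
Proof.
apply/null_content_dominatesP => A mA muA.
by apply/eqP; rewrite eq_le nu_ge0 andbT -muA nu_le.
Qed.

Let f : X -> \bar R := Radon_Nikodym_SigmaFinite.f nu mu.

Let mf : measurable_fun [set: X] f.
Proof.
exact: measurable_int (Radon_Nikodym_SigmaFinite.f_integrable numu).
Qed.

Let f_ge0 x : 0 <= f x. Proof. exact: Radon_Nikodym_SigmaFinite.f_ge0. Qed.

(** On the set where [f] exceeds 1, [nu_le] gives the inequality on integrals opposite to the
    pointwise one, so [f] equals 1 almost everywhere there and that set is null. *)
Let f_min : ae_eq mu setT f (fun x => mine (f x) 1).
Proof.
pose C := [set x | 1 < f x].
have mC : measurable C by rewrite -[C]setTI; exact: emeasurable_fun_o_infty.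
have : ae_eq mu C f (cst 1).
  apply: integral_ae_eq => //.
    by apply: integrableS (Radon_Nikodym_SigmaFinite.f_integrable numu).
  move=> A AC mA; apply/eqP; rewrite eq_le; apply/andP; split.
    rewrite -Radon_Nikodym_SigmaFinite.f_integral// integral_cst//= mul1e.
    exact: nu_le.
  by apply: ge0_le_integral => // [|x /AC /ltW//]; exact: measurable_funTS.
move=> [N [mN N0 CN]]; exists N; split => // x /= fx; apply: CN => /= CE.
by apply: fx => _; case: (leP (f x) 1) => // /CE.
Qed.

(** [F] is the density of [nu] with respect to [mu], that is, the conditional probability of [B]
    given [p]. The section of the region at [x] has noise measure [mine (f x) 1], which is [f x]
    almost everywhere by [f_min]. *)
Lemma slab_exists : exists F : X -> R, [/\ measurable_fun setT F &
  forall A, measurable A ->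
    (mu \x noise R) ([set z | A z.1 /\ (z.2 < F z.1)%R]) = Q (p @^-1` A `&` B)].
Proof.
pose F x := fine (f x).
have mF : measurable_fun setT F by exact: measurableT_comp.
exists F; split => // A mA.
rewrite -[RHS]/(nu A) (Radon_Nikodym_SigmaFinite.f_integral numu)// -/f.
transitivity (\int[mu]_(x in A) (mine (f x) 1)); last first.
  apply: ae_eq_integral => //.
  - by apply: measurable_mine => //; exact: measurable_funTS.
  - exact: measurable_funTS.
  - by apply: ae_eq_subset (ae_eq_sym f_min).
rewrite [RHS]integral_mkcond /product_measure1; apply: eq_integral => x _ /=.
rewrite patchE; case: ifPn => xA.
  rewrite (_ : xsection _ _ = [set u | (u < F x)%R]).
    rewrite noise_lt ?fine_ge0// EFin_min fineK//.
    exact: Radon_Nikodym_SigmaFinite.f_fin_num.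
  apply/seteqP; split => u /=; rewrite /xsection/= inE /=; first by case.
  by split => //; exact: set_mem.
rewrite (_ : xsection _ _ = set0) ?measure0//.
apply/seteqP; split => u //=; rewrite /xsection/= inE /= => -[Ax _].
by rewrite mem_set in xA.
Qed.

End slab.

Definition mk_mfun (d d' : measure_display) (T : sigmaRingType d)
    (U : sigmaRingType d') (f : T -> U) (mf : measurable_fun setT f) :
  {mfun T >-> U} := HB.pack f (isMeasurableFun.Build _ _ _ _ f mf).

Lemma measurable_preimage (d d' : measure_display) (T : measurableType d)
    (U : measurableType d') (f : T -> U) (A : set U) :
  measurable_fun setT f -> measurable A -> measurable (f @^-1` A).
Proof. by move=> mf mA; rewrite -[_ @^-1` _]setTI; exact: mf. Qed.

Lemma negligible_bigcup_rat (d : measure_display) (T : sigmaRingType d)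
    (R : realFieldType) (mu : {measure set T -> \bar R}) (F : rat -> set T) :
  (forall q, mu.-negligible (F q)) -> mu.-negligible (\bigcup_q F q).
Proof.
move=> F0; apply: (@negligibleS _ _ _ _
    (\bigcup_n if unpickle n is Some q then F q else set0)).
  by move=> z [q _ Fqz]; exists (pickle q); [exact: I|rewrite pickleK].
by apply: negligible_bigcup => n; case: unpickle => // ; exact: negligible_set0.
Qed.

Lemma eq_measure_prod (d d' : measure_display) (T : measurableType d)
    (U : measurableType d') (R : realType) (P1 P2 : probability (T * U)%type R) :
  (forall A B, measurable A -> measurable B -> P1 (A `*` B) = P2 (A `*` B)) ->
  same_dist P1 P2.
Proof.
move=> P12 C mC.
apply: (measure_unique [set A `*` B | A in measurable & B in measurable]
  (fun=> setT)) => //.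
- exact: measurable_prod_measurableType.
- move=> _ _ [A1 mA1 [B1 mB1 <-]] [A2 mA2 [B2 mB2 <-]]; rewrite -setXI.
  exists (A1 `&` A2); [exact: measurableI|].
  by exists (B1 `&` B2) => //; exact: measurableI.
- by move=> _; exists setT => //; exists setT => //; rewrite setXTT.
- by rewrite bigcup_const.
- by move=> _ [A mA [B mB <-]]; exact: P12.
- by move=> _; rewrite (le_lt_trans (probability_le1 _ measurableT))// ltry.
Qed.

(** Rays with finite endpoint miss the point +oo, so agreement on them does not give agreement of
    total masses. Hence [setT] is added to the generating pi-system, where it also serves as the
    exhausting cover. *)
Lemma eq_measure_ereal_ray (R : realType) (m1 m2 : {measure set (\bar R) -> \bar R}) :
  (m1 setT < +oo)%E -> m1 setT = m2 setT ->
  (forall t : R, m1 [set x | (x < t%:E)%E] = m2 [set x | (x < t%:E)%E]) ->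
  forall A : set (\bar R), measurable A -> m1 A = m2 A.
Proof.
move=> fin1 m12T m12 A mA.
have GE t : `]-oo, t%:E[%classic = [set x : \bar R | (x < t%:E)%E] by rewrite set_itvNyo.
pose G : set (set (\bar R)) := [set B | B = setT \/ ErealGenInftyO.G B].
have mG : G `<=` measurable.
  by move=> _ [->|[r ->]]; [exact: measurableT|exact: emeasurable_itv].
apply: (g_sigma_algebra_measure_unique G mG (fun=> setT)) => //.
- by move=> _; left.
- by rewrite bigcup_const.
- move=> B C [->|[r ->]] [->|[s ->]]; rewrite ?setTI ?setIT;
    [by left|by right; exists s|by right; exists r|].
  right; exists (Num.min r s); rewrite !GE; apply/seteqP; split => x /=.
    by move=> [xr xs]; rewrite EFin_min lt_min xr.
  by rewrite EFin_min lt_min => /andP.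
- by move=> _ [->//|[r ->]]; rewrite GE.
- have : <<s @ErealGenInftyO.G R >> A.
    by rewrite -[X in X A](ErealGenInftyO.measurableE R).
  by apply: sub_smallest2r => // B GB; right.
Qed.

(** * Sampling by a conditional quantile function *)

Section randomization.
Context (R : realType) (dX dY : measure_display) (X : measurableType dX)
  (Y : measurableType dY) (Q : probability (X * Y)%type R)
  (f : Y -> measurableTypeR R).
Hypothesis f_inj : injective f.
Hypothesis mf : measurable_fun [set: Y] f.
Hypothesis f_image : forall A, measurable A -> measurable (f @` A).

Let mu : probability X R := distribution Q (mk_mfun (@measurable_fst _ _ X Y)).
Let M : probability (X * measurableTypeR R)%type R := (mu \x noise R)%E.

(** [F] is a version of the conditional distribution function of [f y] given [x], at one rational
    level. It is retained so that slabs of two levels can be compared pointwise. *)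
Let slabs (q : rat) : exists E : set (X * measurableTypeR R),
  [/\ measurable E,
      forall A, measurable A -> M (A `*` setT `&` E) = Q (A `*` [set y | f y <= ratr q]) &
      exists F : X -> R, measurable_fun setT F /\ E = [set z | z.2 < F z.1]].
Proof.
have mB : measurable ((f \o snd) @^-1` `]-oo, ratr q] : set (X * Y)).
  apply: measurable_preimage; last exact: measurable_itv.
  by apply: measurableT_comp => //; exact: measurable_snd.
have [F [mF FE]] := slab_exists Q (mk_mfun (@measurable_fst _ _ X Y)) mB.
exists [set z | z.2 < F z.1]; split; last by exists F.
  rewrite (_ : [set z | _] = (fun z => z.2 < F z.1) @^-1` [set true]); last first.
    by apply/seteqP; split => z /=.
  apply: measurable_preimage => //; apply: measurable_fun_ltr => //.
  by apply: (measurableT_comp mF); exact: measurable_fst.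
move=> A mA; transitivity (M [set z | A z.1 /\ z.2 < F z.1]).
  congr (M _); apply/seteqP; split => z /=; first by move=> [[]].
  by move=> [].
exact: FE.
Qed.

Let E (q : rat) := sval (cid (slabs q)).

Let mE q : measurable (E q). Proof. by rewrite /E; case: cid => S /= []. Qed.

Let ME q A : measurable A ->
  M (A `*` setT `&` E q) = Q (A `*` [set y | f y <= ratr q]).
Proof. by rewrite /E; case: cid => S /= [_ + _]; exact. Qed.

Let E_slab q :
  exists F : X -> R, measurable_fun setT F /\ E q = [set z | z.2 < F z.1].
Proof. by rewrite /E; case: cid => S /= []. Qed.

Let mYle r : measurable [set y | f y <= r].
Proof.
rewrite (_ : mkset _ = f @^-1` `]-oo, r]); last first.
  by apply/seteqP; split => y /=; rewrite in_itv.
by apply: measurable_preimage => //; exact: measurable_itv.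
Qed.

Let mXT (A : set X) : measurable A ->
  measurable (A `*` setT : set (X * measurableTypeR R)).
Proof. by move=> mA; exact: measurableX. Qed.

(* On the points [x] where the densities are in the wrong order, [E r] lies
   inside [E q] although it has at least its measure. *)
Let E_mono q r : (q <= r) -> M (E q `\` E r) = 0.
Proof.
move=> qr; have [F [mF EqE]] := E_slab q; have [G [mG ErE]] := E_slab r.
pose B := [set x | G x < F x].
have mB : measurable B.
  rewrite (_ : B = (fun x => G x < F x) @^-1` [set true]).
    by apply: measurable_preimage => //; exact: measurable_fun_ltr.
  by apply/seteqP; split => x /=.
have mS : measurable (E q `\` E r) by exact: measurableD.
have SE : B `*` setT `&` E q = (B `*` setT `&` E r) `|` (E q `\` E r).
  rewrite EqE ErE; apply/seteqP; split => [[x u]|[x u]] /=.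
    move=> [[Bx _] uF]; case: (ltP u (G x)) => uG; [by left|right].
    by split => //=; apply/negP; rewrite -leNgt.
  rewrite /B /= => -[[[Bx _] uG]|[/= uF /negP]].
    by do !split => //; exact: lt_trans Bx.
  by rewrite -leNgt => Gu; do !split => //; exact: le_lt_trans uF.
have MU : M (B `*` setT `&` E q) = (M (B `*` setT `&` E r) + M (E q `\` E r))%E.
  rewrite SE; apply: measureU => //.
    by apply: measurableI => //; exact: mXT.
  by apply/seteqP; split => // z [[_ Er] [_ ]].
move: MU; rewrite ME// ME// => MB; apply/eqP; rewrite eq_le measure_ge0 andbT.
rewrite -(@leeD2lE _ (Q (B `*` [set y | f y <= ratr r]))); last first.
  by apply: fin_num_measure; exact: measurableX.
rewrite adde0 -MB; apply: le_measure; rewrite ?inE; [exact: measurableX..|].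
by move=> [x y] /= [Bx fy]; split => //=; rewrite (le_trans fy)// ler_rat.
Qed.

(** By [E_mono] the slabs increase with the level only up to null sets. This union is increasing
    everywhere and differs from [E q] by a countable union of null sets. *)
Let E' (q : rat) := \bigcup_(r in [set r | r <= q]) E r.

Let mE' q : measurable (E' q).
Proof.
rewrite /E' bigcup_mkcond; apply: bigcupT_measurable_rat => r.
by case: ifP => _ //; exact: mE.
Qed.

Let ME' q A : measurable A ->
  M (A `*` setT `&` E' q) = Q (A `*` [set y | f y <= ratr q]).
Proof.
move=> mA; apply: etrans (ME q mA).
have mD : measurable (A `*` setT `&` E q) by apply: measurableI; [exact: mXT|exact: mE].
have mN : measurable (E' q `\` E q) by apply: measurableD; [exact: mE'|exact: mE].
have -> : A `*` setT `&` E' q = A `*` setT `&` E q `|` (A `*` setT `&` (E' q `\` E q)).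
  by rewrite -setIUr setDUK// => z Eqz; exists q; [exact: lexx|].
apply: measureU0 => //; first by apply: measurableI => //; exact: mXT.
apply: measure_negligible; first by apply: measurableI => //; exact: mXT.
apply: (@negligibleS _ _ _ _ (\bigcup_r if r <= q then E r `\` E q else set0)).
  by move=> z [_ [[r /= rq Erz] NEqz]]; exists r => //; rewrite rq.
apply: negligible_bigcup_rat => r; case: ifPn => [rq|_]; last exact: negligible_set0.
by apply/negligibleP; [apply: measurableD; exact: mE|exact: E_mono].
Qed.

Let E'_sub q r : q <= r -> E' q `<=` E' r.
Proof. by move=> qr z [s /= sq Es]; exists s => //=; exact: le_trans qr. Qed.

(** The conditional quantile function: at [(x, u)], the generalized inverse at [u] of the
    conditional distribution function given [x]. Infinite values arise where the levels containing
    the point are none or all. *)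
Let G (z : X * measurableTypeR R) : \bar R :=
  ereal_inf [set (ratr q)%:E | q in [set q | E' q z]].

Let G_lt (t : R) : [set z | (G z < t%:E)%E] =
  \bigcup_(q in [set q : rat | ratr q < t]) E' q.
Proof.
apply/seteqP; split => z /=.
  by move=> /ereal_inf_lt[_ [q Eq <-]]; rewrite lte_fin => qt; exists q.
move=> [q /= qt Eq]; apply: le_lt_trans (_ : (ratr q)%:E < t%:E)%E.
  by apply: ereal_inf_lbound; exists q.
by rewrite lte_fin.
Qed.

Let mG : measurable_fun setT G.
Proof.
apply: (measurability _ (ErealGenInftyO.measurableE R)) => _ /= -[_ [r ->] <-].
rewrite setTI set_itvNyo /preimage /= G_lt bigcup_mkcond.
by apply: bigcupT_measurable_rat => q; case: ifP => _ //; exact: mE'.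
Qed.

Let rat_seq (t : R) : exists s : rat^nat, [/\ nondecreasing_seq s,
  forall m, ratr (s m) < t & forall r : R, r < t -> exists m, r < ratr (s m)].
Proof.
have H m : exists q : rat, t - m.+1%:R^-1 < ratr q < t - m.+2%:R^-1.
  have : t - m.+1%:R^-1 < t - m.+2%:R^-1 :> R.
    by rewrite ltrD2l ltrN2 ltf_pV2 ?posrE// ltr_nat.
  by move=> /rat_in_itvoo[q]; rewrite inE/= => qq; exists q.
have [s sE] := choice H; exists s; split.
- apply/nondecreasing_seqP => m; rewrite -(ler_rat R); apply: ltW.
  by apply: (@lt_trans _ _ (t - m.+2%:R^-1));
    [have /andP[] := sE m|have /andP[] := sE m.+1].
- move=> m; have /andP[_] := sE m; move=> /lt_le_trans; apply.
  by rewrite gerBl invr_ge0.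
- move=> r rt; have tr0 : 0 < t - r by rewrite subr_gt0.
  have [m /= mtr] : exists m : nat, m.+1%:R^-1 < t - r.
    exists (Num.truncn (t - r)^-1); rewrite invf_plt ?posrE//.
    by rewrite truncnS_gt.
  exists m; have /andP[+ _] := sE m; apply: lt_trans.
  by rewrite ltrBrDl -ltrBrDr.
Qed.

(** [ME'] treats closed rays at rational levels; the open ray at [t] is reached from below along
    [rat_seq], by continuity of both measures on increasing unions. *)
Let MG_lt (t : R) A : measurable A ->
  M (A `*` setT `&` [set z | (G z < t%:E)%E]) = Q (A `*` [set y | f y < t]).
Proof.
move=> mA; have [s [s_nd s_lt s_cvg]] := rat_seq t.
have -> : A `*` setT `&` [set z | (G z < t%:E)%E] = \bigcup_m (A `*` setT `&` E' (s m)).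
  rewrite -setI_bigcupr G_lt; congr (_ `&` _); apply/seteqP; split => z.
    move=> [q /= qt Eq]; have [m qm] := s_cvg _ qt; exists m => //.
    by apply: E'_sub Eq; rewrite ltW// -(ltr_rat R).
  by move=> [m _ Em]; exists (s m) => /=.
have -> : A `*` [set y | f y < t] = \bigcup_m (A `*` [set y | f y <= ratr (s m)]).
  rewrite -setX_bigcupr; congr (_ `*` _); apply/seteqP; split => y /=.
    by move=> /s_cvg[m ym]; exists m => //=; exact: ltW.
  by move=> [m _ /= ym]; exact: le_lt_trans (s_lt m).
have mAE m : measurable (A `*` setT `&` E' (s m)).
  by apply: measurableI; [exact: mXT|exact: mE'].
have mAf m : measurable (A `*` [set y | f y <= ratr (s m)]) by exact: measurableX.
have c1 : M \o (fun m => A `*` setT `&` E' (s m)) @ \oo -->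
    M (\bigcup_m (A `*` setT `&` E' (s m))).
  apply: nondecreasing_cvg_mu => //; first exact: bigcupT_measurable.
  by move=> m n mn; apply/subsetPset; apply: setIS; apply: E'_sub; exact: s_nd.
have c2 : Q \o (fun m => A `*` [set y | f y <= ratr (s m)]) @ \oo -->
    Q (\bigcup_m (A `*` [set y | f y <= ratr (s m)])).
  apply: nondecreasing_cvg_mu => //; first exact: bigcupT_measurable.
  move=> m n mn; apply/subsetPset => -[x y] /= [Ax ym]; split => //=.
  by rewrite (le_trans ym)// ler_rat; exact: s_nd.
have c12 : M \o (fun m => A `*` setT `&` E' (s m)) =
    Q \o (fun m => A `*` [set y | f y <= ratr (s m)]).
  by apply/funext => m; exact: ME'.
by rewrite c12 in c1; exact: cvg_unique c1 c2.
Qed.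

Let mEf : measurable_fun setT (fun z : X * Y => (f z.2)%:E).
Proof.
apply: (measurableT_comp (@EFin_measurable _ setT)).
by apply: (measurableT_comp mf); exact: measurable_snd.
Qed.

Let MG A (C : set (\bar R)) : measurable A -> measurable C ->
  M (A `*` setT `&` G @^-1` C) = Q (A `*` [set y | C (f y)%:E]).
Proof.
move=> mA mC.
have mAY : measurable (A `*` setT : set (X * Y)) by exact: measurableX.
pose m1 := pushforward (mrestr M (mXT mA)) (mk_mfun mG).
pose m2 := pushforward (mrestr Q mAY) (mk_mfun mEf).
have m1E B : m1 B = M (A `*` setT `&` G @^-1` B).
  by rewrite /m1 /pushforward /mrestr setIC.
have m2E B : m2 B = Q (A `*` [set y | B (f y)%:E]).
  rewrite /m2 /pushforward /mrestr setIC; congr (Q _).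
  by apply/seteqP; split => -[x y] /= => [[[]]|[]].
have MT : M (A `*` setT) = Q (A `*` setT).
  apply: etrans (product_measure1E _ _ mA measurableT) _.
  rewrite [X in (_ * X)%E](probability_setT (noise R)) mule1.
  rewrite /mu /distribution /pushforward.
  by congr (Q _); apply/seteqP; split => -[x y] //= [].
rewrite -m1E -m2E; apply: eq_measure_ereal_ray => //.
- apply: le_lt_trans (_ : 1 < +oo)%E; last exact: ltry.
  by rewrite [leLHS]m1E preimage_setT setIT; exact: (probability_le1 _ (mXT mA)).
- by apply: etrans (m1E _) (etrans _ (esym (m2E _))); rewrite preimage_setT setIT MT.
- move=> t; rewrite [LHS]m1E [RHS]m2E.
  rewrite (_ : [set y | _] = [set y | f y < t]); first exact: MG_lt.
  by apply/seteqP; split => y; rewrite /= lte_fin.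
Qed.

(** Inverts [f] at the quantile. The default [y0] is taken only where the quantile is off the range
    of [f], an event that [randomization_real] shows to be null. *)
Let sample (y0 : Y) (z : X * measurableTypeR R) : Y :=
  xget y0 [set y | (f y)%:E = G z].

Let sample_preimage y0 B : sample y0 @^-1` B =
  G @^-1` (EFin @` (f @` B)) `|`
  (~` (G @^-1` (EFin @` (f @` setT))) `&` [set _ | B y0]).
Proof.
apply/seteqP; split => [z /= Bz|z /= [[_ [y By <-] fyG]|[nG By0]]].
- case: (pselect (exists y, (f y)%:E = G z)) => [[y fyG]|nG].
    left; exists (f (sample y0 z)); first by exists (sample y0 z).
    by rewrite /sample; case: xgetP => [_ _ //|/(_ y)].
  right; split; last by move: Bz; rewrite /sample xgetPN// => y fyG; apply: nG; exists y.
  by move=> [_ [y _ <-] fyG]; apply: nG; exists y.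
- rewrite /sample; case: xgetP => [y' -> /=|/(_ y)//].
  by rewrite -fyG => -[/f_inj ->].
- rewrite /sample xgetPN// => y fyG; apply: nG.
  by exists (f y) => //; exists y.
Qed.

Let mGf B : measurable B -> measurable (G @^-1` (EFin @` (f @` B))).
Proof.
move=> mB; apply: measurable_preimage => //.
by apply: measurable_image_EFin; exact: f_image.
Qed.

(** Quantile sampling: jointly with [x], [G] has the law of [f y], so inverting [f] recovers [Q],
    first on rectangles and then everywhere by uniqueness of measures. *)
Lemma randomization_real : exists g : {mfun (X * measurableTypeR R)%type >-> Y},
  forall C, measurable C ->
    (distribution Q (mk_mfun (@measurable_fst _ _ X Y)) \x noise R)%E
      ((fun z => (z.1, g z)) @^-1` C) = Q C.
Proof.
have [y0 _] : [set: Y] !=set0.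
  apply/set0P/eqP => Y0; have := probability_setT Q.
  rewrite (_ : setT = set0) ?measure0; first by move=> /eqP; rewrite lt_eqF// lte_fin.
  by apply/seteqP; split => -[x y] // _; suff : set0 y by []; rewrite -Y0.
have mBy0 (B : set Y) : measurable ([set _ | B y0] : set (X * measurableTypeR R)).
  have [By0|nBy0] := pselect (B y0).
    by rewrite (_ : mkset _ = setT)//; apply/seteqP; split.
  by rewrite (_ : mkset _ = set0)//; apply/seteqP; split.
have mg : measurable_fun setT (sample y0).
  move=> _ B mB; rewrite setTI sample_preimage; apply: measurableU; first exact: mGf.
  by apply: measurableI; [apply: measurableC; exact: mGf|exact: mBy0].
exists (mk_mfun mg).
have mgX : measurable_fun setT (fun z : X * measurableTypeR R => (z.1, sample y0 z)).
  by apply: measurable_fun_pair => //; exact: measurable_fst.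
have MGf A B : measurable A -> measurable B ->
    M (A `*` setT `&` G @^-1` (EFin @` (f @` B))) = Q (A `*` B).
  move=> mA mB; rewrite MG//; last first.
    by apply: measurable_image_EFin; exact: f_image.
  congr (Q (_ `*` _)); apply/seteqP; split => y /=.
    by move=> [_ [y' By' <-] [/f_inj <-]].
  by move=> By; exists (f y) => //; exists y.
have nGf : M (~` (G @^-1` (EFin @` (f @` setT)))) = 0%E.
  rewrite probability_setC; last exact: mGf.
  rewrite -[X in M X]setTI -setXTT MGf//.
  by rewrite setXTT probability_setT subee.
apply: (@eq_measure_prod _ _ _ _ _ (distribution M (mk_mfun mgX)) Q) => A B mA mB.
rewrite -(MGf _ _ mA mB); transitivity (M (A `*` setT `&` sample y0 @^-1` B)).
  by congr (M _); apply/seteqP; split => z /= [] // [].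
rewrite sample_preimage setIUr.
apply: measureU0.
- by apply: measurableI; [exact: mXT|exact: mGf].
- apply: measurableI; [exact: mXT|apply: measurableI; last exact: mBy0].
  by apply: measurableC; exact: mGf.
- apply: (subset_measure0 _ _ _ nGf); last by move=> z [_ []].
  + apply: measurableI; [exact: mXT|apply: measurableI; last exact: mBy0].
    by apply: measurableC; exact: mGf.
  + by apply: measurableC; exact: mGf.
Qed.

End randomization.

(** * Reconstructions driven by the source and a common noise *)

Lemma randomization (R : realType) (dX dY : measure_display)
    (X : measurableType dX) (Y : measurableType dY)
    (Q : probability (X * Y)%type R) : standard_borel R Y ->
  exists g : {mfun (X * measurableTypeR R)%type >-> Y},
  forall C, measurable C ->
    (distribution Q (mk_mfun (@measurable_fst _ _ X Y)) \x noise R)%E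
      ((fun z => (z.1, g z)) @^-1` C) = Q C.
Proof. by move=> [f [f_inj mf fim]]; exact: (randomization_real Q f_inj mf fim). Qed.

Section driven.
Context (R : realType) (dX dY dS : measure_display) (X : measurableType dX)
  (Y : measurableType dY) (S : measurableType dS) (PS : probability S R)
  (src : int -> {RV PS >-> X}).

Definition noisy : probability (S * measurableTypeR R)%type R :=
  (PS \x noise R)%E.

Lemma measurable_attach (dA : measure_display) (A : measurableType dA)
    (a : {mfun S >-> A}) :
  measurable_fun setT (fun w : S * measurableTypeR R => (a w.1, w.2)).
Proof.
apply: measurable_fun_pair; last exact: measurable_snd.
by apply: (measurableT_comp (measurable_funPT a)); exact: measurable_fst.
Qed.

(** A function of a source variable and the noise sees [PS] only through the law of that variable.
    Keeping [mu] as a parameter lets blocks at different times be computed against one common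
    law. *)
Lemma noisyE (dA : measure_display) (A : measurableType dA) (a : {mfun S >-> A})
    (mu : probability A R) (D : set (A * measurableTypeR R)) :
  same_dist (distribution PS a) mu -> measurable D ->
  noisy ((fun w => (a w.1, w.2)) @^-1` D) = (mu \x noise R)%E D.
Proof.
move=> amu mD; apply/esym.
apply: (@product_measure_unique _ _ _ _ _ mu (noise R)
  (distribution noisy (mk_mfun (measurable_attach a)))) => // B C mB mC.
apply: etrans (_ : (distribution PS a B * noise R C)%E = _); last by rewrite amu.
by apply: product_measure1E => //; exact: measurable_preimage.
Qed.

Definition src_copy (k : int) : {RV noisy >-> X} :=
  mk_mfun (measurableT_comp (measurable_funPT (src k))
    (@measurable_fst _ _ S (measurableTypeR R))).

Implicit Types h : int -> {mfun (X * measurableTypeR R)%type >-> Y}.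

Definition driven h (k : int) : {RV noisy >-> Y} :=
  mk_mfun (measurableT_comp (measurable_funPT (h k)) (measurable_attach (src k))).

Lemma src_copy_law : same_process_law src_copy src.
Proof.
move=> k n A mA.
transitivity (noisy ((block src k n @^-1` A) `*` setT)).
  by congr (noisy _); apply/seteqP; split => -[s u] //= [].
apply: etrans (product_measure1E _ _ _ measurableT) _.
  exact: measurable_preimage.
by rewrite [X in (_ * X)%E](probability_setT (noise R)) mule1.
Qed.

Definition drive_block n (H : 'I_n.+1 -> {mfun (X * measurableTypeR R)%type >-> Y})
    (z : n.+1.-tuple X * measurableTypeR R) : n.+1.-tuple X * n.+1.-tuple Y :=
  (z.1, [tuple H i (tnth z.1 i, z.2) | i < n.+1]).

Lemma measurable_drive_block n H : measurable_fun setT (@drive_block n H).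
Proof.
apply: measurable_fun_pair; first exact: measurable_fst.
apply/measurable_fun_tnthP => i.
rewrite (_ : _ \o _ = fun z => H i (tnth z.1 i, z.2)); last first.
  by apply/funext => z /=; rewrite tnth_mktuple.
apply: measurableT_comp => //; apply: measurable_fun_pair; last exact: measurable_snd.
by apply: (measurableT_comp (@measurable_tnth _ _ _ i)); exact: measurable_fst.
Qed.

Lemma driven_block_law h k n (mu : probability (n.+1.-tuple X) R) C :
  same_dist (law (block src k n)) mu -> measurable C ->
  law (rv_pair (block src_copy k n) (block (driven h) k n)) C =
  (mu \x noise R)%E (drive_block (fun i : 'I_n.+1 => h (k + i%:Z)) @^-1` C).
Proof.
move=> kmu mC; rewrite -(noisyE kmu); last first.
  by apply: (measurable_preimage (measurable_drive_block _)).
congr (noisy _); apply/funext => w; congr (C (_, _)).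
apply: eq_from_tnth => i.
rewrite [LHS]tnth_mktuple [RHS]tnth_mktuple; congr (h _ (_, _)).
by rewrite [RHS]tnth_mktuple.
Qed.

Lemma driven_law h k (mu : probability X R) C :
  same_dist (law (src k)) mu -> measurable C ->
  law (rv_pair (src_copy k) (driven h k)) C =
  (mu \x noise R)%E ((fun z => (z.1, h k z)) @^-1` C).
Proof.
move=> kmu mC; rewrite -(noisyE kmu)//.
by apply: measurable_preimage => //; apply: measurable_fun_pair.
Qed.

Lemma law_src_block0 k (mu : probability (1.-tuple X) R) A :
  same_dist (law (block src k 0)) mu -> measurable A ->
  law (src k) A = mu [set v | A (tnth v ord0)].
Proof.
move=> kmu mA; rewrite -kmu; last first.
  exact: (measurable_preimage (@measurable_tnth _ _ _ ord0)).
congr (PS _); apply/funext => s; congr (A _).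
by rewrite /= tnth_mktuple addr0.
Qed.

Hypothesis src_stationary : stationary src.

Lemma stationary_block k k' n :
  same_dist (law (block src k n)) (law (block src k' n)).
Proof.
by move=> A mA; have := @src_stationary k' (k - k') n A mA; rewrite addrC subrK.
Qed.

Lemma stationary_src k k' : same_dist (law (src k)) (law (src k')).
Proof.
move=> A mA; rewrite (law_src_block0 (@stationary_block k k' 0))//.
by rewrite (@law_src_block0 k' (law (block src k' 0))).
Qed.

(** After [driven_block_law], both sides are images of one product measure under one map:
    stationarity equates the source laws, and time enters otherwise only through the driving
    functions. *)
Lemma driven_block_shift h h' k k' n :
  (forall i : 'I_n.+1, h (k + i%:Z) = h' (k' + i%:Z)) ->
  same_dist (law (rv_pair (block src_copy k n) (block (driven h) k n)))
    (law (rv_pair (block src_copy k' n) (block (driven h') k' n))).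
Proof.
move=> hh' C mC; apply: etrans (driven_block_law h (@stationary_block k k' n) mC) _.
have -> : (fun i : 'I_n.+1 => h (k + i%:Z)) = (fun i => h' (k' + i%:Z)).
  by apply/funext => i; rewrite hh'.
by apply/esym; apply: driven_block_law.
Qed.

Lemma driven_shift h h' k k' : h k = h' k' ->
  same_dist (law (rv_pair (src_copy k) (driven h k)))
    (law (rv_pair (src_copy k') (driven h' k'))).
Proof.
move=> hh' C mC; apply: etrans (driven_law h (@stationary_src k k') mC) _.
by rewrite hh'; apply/esym; apply: driven_law.
Qed.

Lemma src_copy_stationary : stationary src_copy.
Proof.
move=> k s n A mA; apply: etrans (@src_copy_law (k + s) n A mA) _.
by apply: etrans (@src_stationary k s n A mA) (esym (@src_copy_law k n A mA)).
Qed.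

End driven.

(** * Realizing prescribed letter laws *)

Section realization.
Context (R : realType) (dX dY dS : measure_display) (X : measurableType dX)
  (Y : measurableType dY) (S : measurableType dS) (PS : probability S R)
  (src : int -> {RV PS >-> X}).
Hypothesis Y_borel : standard_borel R Y.

(** [g] depends on [Q] alone and is chosen before the time and the other drivers, so one function
    can be reused at all times. Feeding it the source instead of the first marginal of [Q] is
    harmless, as both have the same law. *)
Lemma letter_realization (Q : probability (X * Y)%type R) :
  exists g : {mfun (X * measurableTypeR R)%type >-> Y},
  forall k h, has_fst_marginal Q (law (src k)) -> h k = g ->
    same_dist (law (rv_pair (src_copy src k) (driven src h k))) Q.
Proof.
have [g gE] := randomization Q Y_borel; exists g => k h Qk hk C mC.
rewrite (@driven_law _ _ _ _ _ _ _ _ src h k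
  (distribution Q (mk_mfun (@measurable_fst _ _ X Y))))// ?hk ?gE//.
by move=> A mA; rewrite -Qk.
Qed.

Definition unblock (z : 1.-tuple X * 1.-tuple Y) : X * Y :=
  (tnth z.1 ord0, tnth z.2 ord0).

Lemma measurable_unblock : measurable_fun setT unblock.
Proof.
apply: measurable_fun_pair.
  by apply: (measurableT_comp (@measurable_tnth _ _ _ ord0)); exact: measurable_fst.
by apply: (measurableT_comp (@measurable_tnth _ _ _ ord0)); exact: measurable_snd.
Qed.

Definition mkblock (z : X * Y) : 1.-tuple X * 1.-tuple Y :=
  ([tuple z.1 | _ < 1], [tuple z.2 | _ < 1]).

Lemma measurable_mkblock : measurable_fun setT mkblock.
Proof.
apply: measurable_fun_pair; apply/measurable_fun_tnthP => i.
  rewrite (_ : _ \o _ = fst); first exact: measurable_fst.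
  by apply/funext => z; rewrite /= tnth_mktuple.
rewrite (_ : _ \o _ = snd); first exact: measurable_snd.
by apply/funext => z; rewrite /= tnth_mktuple.
Qed.

Lemma unblockK : cancel unblock mkblock.
Proof.
by move=> [v v']; congr pair; apply: eq_from_tnth => i; rewrite tnth_mktuple ord1.
Qed.

Lemma block0_realization (Q : probability (1.-tuple X * 1.-tuple Y)%type R) :
  exists g : {mfun (X * measurableTypeR R)%type >-> Y},
  forall k h, has_fst_marginal Q (law (block src k 0)) -> h k = g ->
    same_dist Q (law (rv_pair (block (src_copy src) k 0) (block (driven src h) k 0))).
Proof.
have [g gE] := letter_realization (distribution Q (mk_mfun measurable_unblock)).
exists g => k h Qk hk C mC; transitivity (Q (unblock @^-1` (mkblock @^-1` C))).
  by congr (Q _); apply/funext => z; congr (C _); rewrite unblockK.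
have mC' : measurable (mkblock @^-1` C).
  by apply: measurable_preimage => //; exact: measurable_mkblock.
rewrite -[LHS](gE k h _ hk _ mC'); last first.
  move=> A mA; rewrite (@law_src_block0 _ _ _ _ _ _ _ k (law (block src k 0)))//.
  rewrite -[RHS]Qk//.
  exact: (measurable_preimage (@measurable_tnth _ _ _ ord0)).
congr (noisy _ _); apply/funext => w; congr (C (_, _)).
  by apply: eq_from_tnth => i; rewrite [LHS]tnth_mktuple [RHS]tnth_mktuple ord1 addr0.
by apply: eq_from_tnth => i; rewrite [LHS]tnth_mktuple [RHS]tnth_mktuple ord1 addr0.
Qed.

End realization.

(** * Oscillating concatenations *)

Section mixed_cuts.
Context (beta : nat -> bool) (n : nat).

Definition count_long (i : nat) : nat := (\sum_(0 <= l < i) beta l)%N.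

(** Starting time of segment [i] when segments are laid end to end from time 1, with [n + 1] letters
    if [beta] holds and a single letter otherwise. *)
Definition cut (i : nat) : nat := (i + n * count_long i).+1.

Lemma count_longS i : count_long i.+1 = (count_long i + beta i)%N.
Proof. by rewrite /count_long big_nat_recr. Qed.

Lemma cutS i : cut i.+1 = (cut i + (n * beta i).+1)%N.
Proof. by rewrite /cut count_longS mulnDr; lia. Qed.

Lemma pred_cut i : (cut i).-1 = (i + n * count_long i)%N.
Proof. by []. Qed.

Lemma cut_ltn i i' : (i < i')%N -> (cut i < cut i')%N.
Proof.
elim: i' => // i' IH; rewrite ltnS leq_eqVlt => /orP[/eqP<-|/IH];
  by rewrite cutS; lia.
Qed.

Lemma cut_leq i i' : (i <= i')%N -> (cut i <= cut i')%N.
Proof. by rewrite leq_eqVlt => /orP[/eqP->//|/cut_ltn/ltnW]. Qed.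

Variable j0 : nat.
Hypothesis j0n : (j0 <= n)%N.

Definition marked (t : nat) : bool := `[< exists2 i, beta i & t = (cut i + j0)%N >].

(** Segments are disjoint and [j0n] keeps each mark inside its own segment, so only segment [i] can
    mark a time in it. *)
Lemma markedE i t : (cut i <= t < cut i.+1)%N ->
  marked t = beta i && (t == cut i + j0)%N.
Proof.
move=> /andP[it ti]; apply/idP/idP => [/asboolP[i' bi' ti']|/andP[bi /eqP ->]];
  last by apply/asboolP; exists i.
suff ii' : i = i' by rewrite ii' bi' ti' eqxx.
have := cutS i'; rewrite bi' muln1 => ci'.
by case: (ltngtP i i') => // [/cut_leq|/cut_leq]; lia.
Qed.

Lemma sum_marked i : (\sum_(1 <= t < cut i) marked t)%N = count_long i.
Proof.
elim: i => [|i IH].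
  have c0 : count_long 0 = 0%N by rewrite /count_long big_geq.
  by rewrite c0 big_geq// /cut c0 muln0.
rewrite (@big_cat_nat _ _ _ (cut i))//=; last exact/cut_leq.
rewrite IH count_longS; congr addn.
rewrite (eq_big_nat _ _ (F2 := fun t => (beta i && (t == cut i + j0)) : nat)); last first.
  by move=> t /markedE ->.
case bi : (beta i) => /=; last by rewrite big1.
rewrite (bigD1_seq (cut i + j0)%N) ?iota_uniq//=.
  by rewrite eqxx big1// => t /negbTE ->.
by rewrite mem_index_iota leq_addr cutS bi muln1; lia.
Qed.

End mixed_cuts.

(* [beta] is constant on the dyadic intervals, alternating between them, so
   the frequency of [true] oscillates. *)
Definition dyadic (i : nat) : bool := odd (trunc_log 2 i).

Lemma trunc_log_dyadic k i : (2 ^ k <= i < 2 ^ k.+1)%N -> trunc_log 2 i = k.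
Proof. by move=> ?; apply: trunc_log_eq. Qed.

Lemma count_long_even j :
  count_long dyadic (2 ^ j.*2.+1) = count_long dyadic (2 ^ j.*2).
Proof.
rewrite /count_long (@big_cat_nat _ _ _ (2 ^ j.*2))//=; last by rewrite leq_exp2l.
rewrite [X in (_ + X)%N]big1_seq ?addn0// => i /=.
by rewrite mem_index_iota => /trunc_log_dyadic; rewrite /dyadic => ->; rewrite odd_double.
Qed.

(** The last dyadic interval alone suffices: [dyadic] is true throughout it, and it holds half of
    all the indices. *)
Lemma count_long_odd j : (2 ^ j.*2.+1 <= count_long dyadic (2 ^ j.+1.*2))%N.
Proof.
rewrite /count_long (@big_cat_nat _ _ _ (2 ^ j.*2.+1))//=; last by rewrite leq_exp2l.
apply: leq_trans (leq_addl _ _).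
rewrite (eq_big_nat _ _ (F2 := fun=> 1%N)); last first.
  by move=> i /trunc_log_dyadic; rewrite /dyadic => ->; rewrite /= odd_double.
by rewrite sum_nat_const_nat doubleS [in X in (X - _)%N]expnS; lia.
Qed.

Lemma count_long_le beta i : (count_long beta i <= i)%N.
Proof.
elim: i => [|i IH]; first by rewrite /count_long big_geq.
by rewrite count_longS; case: (beta i); lia.
Qed.

(** * Divergence of the means *)

Section means.
Context (R : realType).

(** With [a] segments, [N] of them long, and [L] extra letters per long one, these are the
    frequencies of marks before and after adding [a] single letters. Their difference is N a / (p
    q), where p q is at most (L + 1) (L + 2) a^2 and N is at least a / 2. *)
Lemma frequency_gap (a N L : R) : 0 < a -> 0 <= N -> 0 <= L -> N <= a -> a <= N *+ 2 ->
  (L + 1)^-1 * (L + 2)^-1 / 2 <= N / (a + L * N) - N / (a *+ 2 + L * N).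
Proof.
move=> a0 N0 L0 Na aN.
set p := a + L * N; set q := a *+ 2 + L * N.
have LN : 0 <= L * N by exact: mulr_ge0.
have LNa : L * N <= L * a by exact: ler_wpM2l.
have p0 : 0 < p by rewrite /p; lra.
have q0 : 0 < q by rewrite /q; lra.
have pq : p * q <= ((L + 1) * a) * ((L + 2) * a).
  by apply: ler_pM; [exact: ltW|exact: ltW|rewrite /p; lra|rewrite /q; lra].
have -> : N / p - N / q = N * a / (p * q).
  rewrite -mulf_div -mulrBr -mulrA; congr (_ * _).
  rewrite (_ : a = q - p); last by rewrite /p /q; ring.
  by field; rewrite !gt_eqF.
rewrite ler_pdivlMr ?mulr_gt0//.
apply: le_trans (_ : (L + 1)^-1 * (L + 2)^-1 / 2 *
    ((L + 1) * a * ((L + 2) * a)) <= _).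
  by rewrite ler_wpM2l// divr_ge0// mulr_ge0// invr_ge0; lra.
rewrite [leLHS](_ : _ = a * (a / 2)); last by field; rewrite !gt_eqF//; lra.
by rewrite [leRHS]mulrC ler_pM2l//; lra.
Qed.

(** [(cut dyadic n i).-1] counts the letters of the first [i] segments. From i = 2^(2j) to i =
    2^(2j+1) no mark is added while the number of segments doubles, so the mean moves by at least
    the fixed amount [dl], for arbitrarily large j. *)
Lemma mean_oscillates (n : nat) (c b : R) (m : nat -> R) (l : R) :
  b != c ->
  (forall i, (0 < i)%N -> m (cut dyadic n i).-1 =
     c + (b - c) * (count_long dyadic i)%:R / (cut dyadic n i).-1%:R) ->
  ~ (m @ \oo --> l).
Proof.
move=> bc mE ml.
pose L : R := n%:R.
pose dl := `|b - c| * ((L + 1)^-1 * (L + 2)^-1 / 2).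
have dl0 : 0 < dl.
  by rewrite mulr_gt0 ?normr_gt0 ?subr_eq0// divr_gt0// mulr_gt0// invr_gt0 ltr_wpDl.
have /cvgrPdist_lt/(_ (dl / 2)) : m @ \oo --> l by [].
rewrite divr_gt0// => /(_ isT)[k _ km].
have big i : (k <= i)%N -> (k <= (cut dyadic n i).-1)%N.
  by move=> ki; rewrite pred_cut; lia.
(* [j] is [k.+1] so that [count_long_odd k] applies at 2^(2j): at least half of the segments before
   that index are long. *)
have [j [kj jN]] : exists j, (k <= 2 ^ j.*2)%N /\
    (2 ^ j.*2 <= count_long dyadic (2 ^ j.*2) * 2)%N.
  exists k.+1; split.
    by apply: leq_trans (ltnW (ltn_expl _ (isT : (1 < 2)%N))); lia.
  have := count_long_odd k.
  rewrite -[in X in X -> _](leq_pmul2r (isT : (0 < 2)%N)) doubleS.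
  by apply: leq_trans; rewrite -expnSr.
have kj' : (k <= 2 ^ j.*2.+1)%N by apply: leq_trans kj _; rewrite leq_exp2l.
have := km _ (big _ kj); have := km _ (big _ kj') => /= m2 m1.
have : `|m (cut dyadic n (2 ^ j.*2)).-1 - m (cut dyadic n (2 ^ j.*2.+1)).-1| < dl.
  rewrite -(subrKA l) (splitr dl) (le_lt_trans (ler_normD _ _))// ltrD//.
  by rewrite distrC.
apply/negP; rewrite -leNgt !mE ?expn_gt0//.
rewrite !pred_cut count_long_even.
rewrite opprD addrACA subrr add0r -!mulrA -mulrBr normrM /dl ler_wpM2l//.
apply: le_trans (ler_norm _).
have e2 : (2 ^ j.*2.+1)%:R = (2 ^ j.*2)%:R *+ 2 :> R.
  by rewrite expnSr natrM mulr_natr.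
rewrite !natrD !(natrM _ n) e2.
apply: frequency_gap => //.
- by rewrite ler_nat count_long_le.
- by rewrite -mulrnA ler_nat.
Qed.

End means.

(** * The average distortion and the contradiction *)

Lemma avg_distortionE (R : realType) (dX dY d : measure_display)
    (X : measurableType dX) (Y : measurableType dY) (T : measurableType d)
    (P : probability T R) (x : int -> {RV P >-> X}) (y : int -> {RV P >-> Y})
    (rho : probability (X * Y)%type R -> R) (b c : R) (mk : nat -> bool) :
  (forall t : nat, (0 < t)%N ->
    rho (law (rv_pair (x t%:Z) (y t%:Z))) = if mk t then b else c) ->
  forall n, (0 < n)%N -> avg_distortion x y rho n =
    c + (b - c) * (\sum_(1 <= t < n.+1) mk t)%:R / n%:R.
Proof.
move=> rhoE n n0; rewrite /avg_distortion.
rewrite (eq_big_nat _ _ (F2 := fun t => c + (b - c) * (mk t)%:R)); last first.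
  move=> t /andP[t0 _]; rewrite rhoE//.
  by case: (mk t); rewrite ?mulr1 ?mulr0 ?addr0// addrC subrK.
have n0R : n%:R != 0 :> R by rewrite pnatr_eq0 -lt0n.
rewrite big_split/= sumr_const_nat subSS subn0 -mulr_sumr -natr_sum.
rewrite mulrDr -(mulr_natl c) mulrA mulVf// mul1r; congr (_ + _).
by rewrite mulrC.
Qed.

Theorem lemma1 (R : realType) (dX dY dS : measure_display)
    (X : measurableType dX) (Y : measurableType dY)
    (Y_borel : standard_borel R Y)
    (S : measurableType dS) (PS : probability S R)
    (src : int -> {RV PS >-> X})
    (rho : probability (X * Y)%type R -> R)
    (rho_ge0 : forall Q : probability (X * Y)%type R, 0 <= rho Q)
    (rho_dist : forall Q Q' : probability (X * Y)%type R,
       same_dist Q Q' -> rho Q = rho Q')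
    (D : R) (D_ge0 : 0 <= D)
    (nonvacuous : ~ vacuous_criterion src rho D) :
  ~ (exists W : dist_sets R X Y,
       [/\ distortion_feasible src W,
           shift_invariant W &
           forall (d : measure_display) (T : measurableType d)
             (P : probability T R)
             (x : int -> {RV P >-> X}) (y : int -> {RV P >-> Y}),
             in_W src x y W <-> in_A src x y rho D]).
Proof.
move=> [W [W_feas W_shift WA]].
have W_from n (k k' : int) : 1 <= k + n%:Z -> k <= k' -> W k' n = W k n.
  move=> kn; rewrite le_eqVlt => /orP[/eqP -> //|kk'].
  have -> : k' = k + `|k' - k|%N%:Z by lia.
  by apply: W_shift => //; lia.
(* [W_from] lets one choice serve all times from 1 on; at earlier times the sets [W k 0] may differ,
   hence the cap [Num.min k 1]. *)
have [Qf [WQf Qf1]] : exists Qf : int -> probability (1.-tuple X * 1.-tuple Y)%type R,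
    (forall k, W k 0 (Qf k)) /\ (forall k : int, 1 <= k -> Qf k = Qf 1).
  have W0 k : exists Q, W k 0 Q by have [] := W_feas k 0.
  have [Qg WQg] := choice W0.
  exists (fun k => Qg (Num.min k 1)); split.
    move=> k; case: (leP k 1) => // k1.
    by rewrite (W_from 0 1 k)// ltW.
  by move=> k k1; rewrite minxx (min_idPr k1).
have [G GP] := choice (@block0_realization R dX dY dS X Y S PS src Y_borel).
pose h0 k := G (Qf k).
have h01 (k : int) : 1 <= k -> h0 k = h0 1 by move=> k1; rewrite /h0 Qf1.
pose x := src_copy src.
pose y (h : int -> {mfun (X * measurableTypeR R)%type >-> Y}) := driven src h.
have W_letter h k : h k = h0 k ->
    W k 0 (law (rv_pair (block x k 0) (block (y h) k 0))).
  move=> hk; have [_ Wk Wsame] := W_feas k 0.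
  by apply: Wsame (WQf k); apply: (GP (Qf k)) => //; apply: Wk; exact: WQf.
have in_W0 : in_W src x (y h0) W.
  split; first exact: src_copy_law.
  exists id; split => //.
  - by move=> i; lia.
  - by move=> M; exists M.
  - by move=> M; exists M.
  - move=> i n in_; have -> : n = 0 by lia.
    exact: W_letter.
(* Passing from [W] to the fidelity set yields stationarity and a limit at most [D], which turns out
   to be [c]. *)
have [_ x_stat [l avg_l lD]] := (WA _ _ _ _ _).1 in_W0.
have src_stat : stationary src.
  move=> k s n A mA; have := @src_copy_law _ _ _ _ _ PS src.
  by move=> law_x; apply: etrans (esym (law_x _ _ _ mA)) (etrans _ (law_x _ _ _ mA));
    exact: x_stat.
pose c := rho (law (rv_pair (x 1) (y h0 1))).
have rho_c h k : h k = h0 1 -> rho (law (rv_pair (x k) (y h k))) = c.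
  by move=> hk; apply: rho_dist; exact: driven_shift.
have cD : c <= D.
  suff <- : l = c by [].
  suff avg_c : avg_distortion x (y h0) rho @ \oo --> c by exact: cvg_unique avg_l avg_c.
  apply: cvg_near_cst; exists 1%N => // n /= n0.
  rewrite (@avg_distortionE _ _ _ _ _ _ _ _ _ _ _ c c (fun=> true))// => [|t t0].
    by rewrite subrr mul0r mul0r addr0.
  by rewrite rho_c// h01.
(* Were every admissible letter law of distortion [c], the criterion would be vacuous with this [c].
   The other value [b] may well exceed [D]. *)
have [kb [Qb [Qb_src]]] : exists k (Q : probability (X * Y)%type R),
    has_fst_marginal Q (law (src k)) /\ rho Q != c.
  apply: contrapT => nQ; apply: nonvacuous; split => //; exists c => // k Q Qk.
  by apply/eqP; apply/negP => /negP rQ; apply: nQ; exists k, Q.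
have [gb gbP] := @letter_realization R dX dY dS X Y S PS src Y_borel Qb.
set b := rho Qb => bc.
have rho_b h k : h k = gb -> rho (law (rv_pair (x k) (y h k))) = b.
  move=> hk; apply: rho_dist => C mC.
  rewrite (@driven_shift _ _ _ _ _ _ _ _ _ src_stat h (fun=> gb) k kb hk)//.
  exact: gbP.
have in_A_src h (l' : R) : l' <= D ->
    avg_distortion x (y h) rho @ \oo --> l' -> in_A src x (y h) rho D.
  move=> l'D hl'; split; [exact: src_copy_law|exact: src_copy_stationary|].
  by exists l'.
pose h1 (k : int) := if k == 1 then gb else h0 1.
have in_W1 : in_W src x (y h1) W.
  (* One exceptional letter contributes [(b - c) / n] to the average, which vanishes in the limit.
     The shift by one index avoids n = 0. *)
  apply/WA; apply: (in_A_src _ c) => //; rewrite -cvg_shiftS.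
  rewrite (_ : (fun m => _) = (fun m => c + (b - c) * harmonic m)).
    have : c + (b - c) * harmonic m @[m --> \oo] --> c + (b - c) * 0.
      by apply: cvgD; [exact: cvg_cst|apply: cvgM; [exact: cvg_cst|exact: cvg_harmonic]].
    by rewrite mulr0 addr0.
  apply/funext => m.
  rewrite (@avg_distortionE _ _ _ _ _ _ _ _ _ _ _ b c (fun t => t == 1%N))//.
    rewrite big_ltn//= big1_seq ?addn0 ?mulr1// => t /=.
    by rewrite mem_index_iota; case: t => [|[]].
  move=> t t0; case: eqP => [->|t1]; [rewrite rho_b//|rewrite rho_c//].
  by rewrite /h1; case: eqP => // -[].
have [k1 [n [j0 [k1j0 j0n Wk1]]]] : exists k1 n j0, [/\ k1 + j0%:Z = 1, (j0 <= n)%N &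
    W k1 n (law (rv_pair (block x k1 n) (block (y h1) k1 n)))].
  have [_ [k [k_lt k_top k_bot Wk]]] := in_W1.
  have [Nt Nt2] := k_top 2; have [Nb Nb1] := k_bot 1.
  have ex : exists m : nat, 1 < k (Nb + m%:Z).
    by exists `|Nt - Nb|%N; have := Nt2 (Nb + `|Nt - Nb|%N%:Z); lia.
  (* The first cut after time 1, searched from a cut at or before it, bounds the block that contains
     time 1. *)
  case: (ex_minnP ex) => -[|m] km m_min.
    by have := Nb1 _ (lexx Nb); rewrite addr0 in km; lia.
  have {m_min} km' : k (Nb + m%:Z) <= 1.
    by rewrite leNgt; apply/negP => /m_min; rewrite ltnn.
  have km1 : k (Nb + m%:Z + 1) = k (Nb + m.+1%:Z) by congr k; lia.
  exists (k (Nb + m%:Z)), (absz (k (Nb + m%:Z + 1) - 1 - k (Nb + m%:Z))%R),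
    (absz (1 - k (Nb + m%:Z))%R); split; [lia|lia|].
  by apply: Wk; lia.
pose mk t := marked dyadic n j0 t.
pose h2 (k : int) := if k is Posz t then
  if (0 < t)%N then (if mk t then gb else h0 1) else h0 k else h0 k.
(* [Negz 0] is -1, sent to 0, and index 0 is sent to [cut] at 0, which is 1: the single-letter
   segments up to time 0 meet the mixed ones at time 1. *)
pose k2 (i : int) : int := match i with
  | Posz m => cut dyadic n m | Negz m => - m%:Z end.
have in_W2 : in_W src x (y h2) W.
  have k2S i : k2 (i + 1) =
      k2 i + (if i is Posz m then (n * dyadic m).+1 else 1%N)%:Z.
    case: i => [m|[|m]].
    - rewrite (_ : Posz m + 1 = Posz m.+1) /k2; last by lia.
      by rewrite cutS.
    - rewrite /k2 /= /cut /count_long big_geq//=; lia.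
    - rewrite (_ : Negz m.+1 + 1 = Negz m) /k2; lia.
  split; first exact: src_copy_law.
  exists k2; split.
  - by move=> i; rewrite k2S ltrDl; case: i.
  - move=> M; exists `|M|%N%:Z => -[m|m] Mm; last by lia.
    by rewrite /k2 /cut; lia.
  - move=> M; exists (- `|M|%N%:Z - 1) => -[m|m] Mm; first by lia.
    by rewrite /k2; lia.
  - move=> i n'; rewrite k2S; case: i => [m|m] in_; last first.
      have -> : n' = 0 by lia.
      by apply: W_letter; rewrite /h2 /k2; case: m {in_}.
    have mkm t : (cut dyadic n m <= t < cut dyadic n m.+1)%N ->
      mk t = dyadic m && (t == cut dyadic n m + j0)%N by exact: markedE.
    have h2E t : (0 < t)%N -> h2 t%:Z = if mk t then gb else h0 1.
      by move=> t0; rewrite /h2 t0.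
    case bm : (dyadic m) in_ mkm; rewrite ?muln1 ?muln0 => in_ mkm; last first.
      have -> : n' = 0 by lia.
      by apply: W_letter; rewrite /k2 h2E// mkm ?h01// leqnn cutS bm; lia.
    have -> : n' = n by lia.
    have [_ _ Wsame] := W_feas (k2 m) n.
    (* [j0 <= n] makes the last time [k1 + n] at least 1, and [k1] is at most 1, hence at most the
       cut, so [W_from] identifies the two sets. The drivers then agree because in either block the
       only use of [gb] is at offset [j0]. *)
    rewrite (W_from n k1) in Wsame; [|lia|rewrite /k2 /cut; lia].
    rewrite (W_from n k1); [|lia|rewrite /k2 /cut; lia].
    apply: Wsame Wk1; apply: driven_block_shift => // i.
    have ti : (cut dyadic n m <= cut dyadic n m + i < cut dyadic n m.+1)%N.
      by rewrite cutS bm muln1 leq_addr ltn_add2l /=.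
    rewrite -[k2 m + _]/((cut dyadic n m + i)%N%:Z) h2E ?addn_gt0// mkm// /h1.
    by rewrite eqn_add2l; case: eqP; case: eqP => //; lia.
(* Membership in the fidelity set demands that the limit exist, whatever its value, and
   [mean_oscillates] excludes this. *)
have [_ _ [l2 avg_l2 _]] := (WA _ _ _ _ _).1 in_W2.
apply: (@mean_oscillates R n c b _ l2 bc _ avg_l2) => i i0.
rewrite (@avg_distortionE _ _ _ _ _ _ _ _ _ _ _ b c mk).
- have sum_mk : (\sum_(1 <= t < cut dyadic n i) mk t)%N = count_long dyadic i.
    exact: sum_marked.
  by rewrite prednK// sum_mk.
- move=> t t0; rewrite -[RHS]/(if mk t then b else c).
  by case mkt : (mk t); [rewrite rho_b|rewrite rho_c]; rewrite //= t0 mkt.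
- by rewrite pred_cut addn_gt0 i0.
Qed.
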